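(* For any integer $p$ there is a shock wave type solution of the Hopf equation $u_t+uu_x=0$ up to $e^{-p}$ in the sense of $\mathbf{R}\langle\varepsilon\rangle$-distributions, i.e. a function $$w(t,x,\varepsilon)=h_0+\Delta h\, K\!\left(\frac{x-at}{\varepsilon}\right),$$ with $h_0,\Delta h,a$ real numbers, $\Delta h\neq0$, $K(x)=\int_{-\infty}^x\theta(y)\,dy$, $\theta\in\mathcal{S}(\mathbf{R})$, $\int_{-\infty}^{+\infty}\theta(y)\,dy=1$, such that for every $t\in[0,T]$ and every $\psi\in\mathcal{S}(\mathbf{R})$, $$\int_{-\infty}^{+\infty}\{w_t(t,x,\varepsilon)+w(t,x,\varepsilon)w_x(t,x,\varepsilon)\}\psi(x)\,dx=\sum_{k=p}^{+\infty}\eta_k\varepsilon^k\in\mathbf{R}\langle\varepsilon\rangle .$$ Moreover, $$\frac{a-h_0}{\Delta h}=\frac12.$$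
   Context: $\mathbf{R}\langle\varepsilon\rangle$ is the field of formal Laurent series $\sum_{n\ge 0}\xi_{n+k}\varepsilon^{n+k}$ ($k\in\mathbf{Z}$, $\xi_i\in\mathbf{R}$) with the non-Archimedean norm $|x|_\nu=e^{-\nu(x)}$, where $\nu(x)$ is the lowest exponent with nonzero coefficient ($\nu(0)=\infty$). An integral depending on $\varepsilon\in(0,1]$ is regarded as an element of $\mathbf{R}\langle\varepsilon\rangle$ via its expansion in powers of $\varepsilon$; ''solution up to $e^{-p}$'' means this element has the form $\sum_{k\ge p}\eta_k\varepsilon^k$. $T>0$ is a fixed time horizon and $\mathcal{S}(\mathbf{R})$ is the Schwartz space. *)

(* Defs.v *)
From HB Require Import structures.
From mathcomp Require Import all_boot all_order all_algebra.
From mathcomp Require Import all_classical all_reals all_analysis.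
Set Implicit Arguments. Unset Strict Implicit. Unset Printing Implicit Defensive.
Import Order.TTheory GRing.Theory Num.Theory.
Import numFieldNormedType.Exports.
Local Open Scope classical_set_scope.
Local Open Scope ring_scope.

Section Defs.
Variable R : realType.

Definition schwartz (f : R -> R) : Prop :=
  (forall (n : nat) (x : R), derivable (derive1n n f) x 1) /\
  (forall k n : nat, exists C : R, forall x : R,
      `|x| ^+ k * `|derive1n n f x| <= C).

Definition primitive (theta : R -> R) (x : R) : R :=
  Rintegral (@lebesgue_measure R) `]-oo, x] theta.

Definition shock_wave (h0 dh a : R) (theta : R -> R) (t x e : R) : R :=
  h0 + dh * primitive theta ((x - a * t) / e).

Definition hopf_pairing (w : R -> R -> R -> R) (psi : R -> R) (t e : R) : R :=
  Rintegral (@lebesgue_measure R) setT (fun x =>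
    ((derive1 (fun s => w s x e) t) + w t x e * derive1 (fun y => w t y e) x)
      * psi x).

(** F, viewed as an element of R<eps> via its asymptotic expansion in powers
    of eps as eps -> 0+, has the form sum_{k >= p} eta_k eps^k. *)
Definition up_to_order (p : int) (F : R -> R) : Prop :=
  exists eta : nat -> R, forall N : nat,
    exists C delta : R, 0 < delta /\ forall e : R, 0 < e -> e <= delta ->
      `|F e - \sum_(i < N) eta i * e ^ (p + (i : nat)%:Z)| <= C * e ^ (p + N%:Z).

End Defs.

(* Main.v *)
(** With [h0 = 0], [dh = 1], [a = 1/2] and [K = (1 + V)/2], the change of variable
    [x = t/2 + e y] turns the pairing into [1/8] times the integral of
    [(V^2)'(y) psi(t/2 + e y)].  Expanding [psi] by Taylor's formula, it is enough
    that the moments of [(V^2)'] of order less than [p] vanish.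

    Being a condition on [W = V^2], this is linear: starting from [tanh^2], one
    cancels the moments one at a time by subtracting a multiple of [W] from a
    dilate of [W].  For a large dilation factor the multiple is small, hence
    [W / tanh^2] stays smooth and bounded below by a positive constant, and
    [V = tanh sqrt(W / tanh^2)] is smooth, with [V'] a Schwartz function. *)

Require Import Defs.
From mathcomp Require Import all_boot all_order all_algebra.
From mathcomp Require Import all_classical all_reals all_analysis.
From mathcomp Require Import measurable_realfun.
From mathcomp Require Import ring lra.
Import Order.TTheory GRing.Theory Num.Theory.
Import numFieldNormedType.Exports.
Local Open Scope classical_set_scope.
Local Open Scope ring_scope.
Set Implicit Arguments. Unset Strict Implicit. Unset Printing Implicit Defensive.

(** * Functions all of whose derivatives satisfy a growth condition *)

Section SmoothClasses.
Context {R : realType}.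
Implicit Types (f g u : R -> R) (D E : (R -> R) -> Prop) (n m k : nat) (x a : R).

Definition bounded f := exists C : R, forall x, `|f x| <= C.

Definition rapid f :=
  forall k : nat, exists C : R, forall x, `|x| ^+ k * `|f x| <= C.

(** The predicate [D] is the growth condition imposed on the function and on its
    derivatives; [smooth rapid] is the Schwartz space. *)
Fixpoint smooth_upto D n f : Prop :=
  D f /\ if n is m.+1 then (forall x, derivable f x 1) /\ smooth_upto D m (derive1 f)
         else True.

Definition smooth D f := forall n, smooth_upto D n f.

Lemma eq_is_derive f g x (a b : R) :
  is_derive x 1 f a -> f =1 g -> a = b -> is_derive x 1 g b.
Proof. by move=> + /funext <- <-. Qed.

Lemma is_derive_derive1 f x (a : R) : is_derive x 1 f a -> derive1 f x = a.
Proof. by move=> fa; rewrite derive1E; apply: derive_val. Qed.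

Lemma is_derive_mull a x : is_derive x 1 (fun y : R => a * y) a.
Proof.
apply: eq_is_derive (is_deriveZ a (is_derive_id x (1 : R))) _ _ => //.
by rewrite /GRing.scale/= mulr1.
Qed.

Lemma derivable_continuous f : (forall x, derivable f x 1) -> continuous f.
Proof. by move=> df x; exact/differentiable_continuous/derivable1_diffP/df. Qed.

Lemma is_derive_continuous f g :
  (forall x, is_derive x 1 f (g x)) -> continuous f.
Proof. by move=> fg; apply: derivable_continuous => x; have := fg x => /@ex_derive. Qed.

Lemma rapid_bounded f : rapid f -> bounded f.
Proof. by move=> /(_ 0%N)[C hC]; exists C => x; have := hC x; rewrite expr0 mul1r. Qed.

Lemma boundedD f g : bounded f -> bounded g -> bounded (f \+ g).
Proof.
move=> [C hC] [E hE]; exists (C + E) => x.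
by rewrite (le_trans (ler_normD _ _))// lerD.
Qed.

Lemma boundedM f g : bounded f -> bounded g -> bounded (f \* g).
Proof. by move=> [C hC] [E hE]; exists (C * E) => x; rewrite normrM ler_pM. Qed.

Lemma bounded_dilation a f : bounded f -> bounded (fun x => f (a * x)).
Proof. by move=> [C hC]; exists C. Qed.

Lemma rapidD f g : rapid f -> rapid g -> rapid (f \+ g).
Proof.
move=> hf hg k; have [C hC] := hf k; have [E hE] := hg k.
exists (C + E) => x; apply: (@le_trans _ _ (`|x| ^+ k * (`|f x| + `|g x|))).
  by rewrite ler_wpM2l ?exprn_ge0// ler_normD.
by rewrite mulrDr lerD.
Qed.

Lemma rapidM f g : rapid f -> bounded g -> rapid (f \* g).
Proof.
move=> hf [E hE] k; have [C hC] := hf k; exists (C * E) => x.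
by rewrite normrM mulrA ler_pM// mulr_ge0// exprn_ge0.
Qed.

Lemma rapidX m f : rapid f -> rapid (fun x => x ^+ m * f x).
Proof.
move=> hf k; have [C hC] := hf (k + m)%N; exists C => x.
by rewrite normrM normrX mulrA -exprD.
Qed.

Lemma rapid_dilation a f : a != 0 -> rapid f -> rapid (fun x => f (a * x)).
Proof.
move=> a0 hf k; have [C hC] := hf k; exists (`|a| ^- k * C) => x.
have ak : 0 < `|a| ^+ k by rewrite exprn_gt0// normr_gt0.
by rewrite -(ler_pM2l ak) [leRHS]mulrA divff ?gt_eqF// mul1r mulrA -exprMn -normrM.
Qed.

(** Induction step for the smoothness proofs below: the derivative is supplied as an explicit
    formula [g], so no rewriting of [derive1 f] is needed. *)
Lemma smooth_uptoP D n f g : D f -> (forall x : R, is_derive x 1 f (g x)) ->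
  smooth_upto D n g -> smooth_upto D n.+1 f.
Proof.
move=> Df fg hg; split=> //; split=> [x|]; first exact: ex_derive.
suff -> : (derive1 f) = g by [].
by apply/funext => x; exact: is_derive_derive1.
Qed.

Lemma smooth_uptoW D n f : smooth_upto D n.+1 f -> smooth_upto D n f.
Proof.
elim: n f => [|n IH] f /= [Df [df hf]]; first by [].
by split=> //; split=> //; exact: IH.
Qed.

Lemma smooth_upto_sub D E n f : (forall u, D u -> E u) ->
  smooth_upto D n f -> smooth_upto E n f.
Proof.
move=> DE; elim: n f => [|n IH] f /=; first by move=> [/DE].
by move=> [/DE Ef [df /IH hf]].
Qed.

Lemma smooth_derivable D f : smooth D f -> forall x, derivable f x 1.
Proof. by move=> /(_ 1%N)[_ []]. Qed.

Arguments smooth_derivable {D f} _ _.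

Lemma smooth_is_derive D f : smooth D f -> forall x, is_derive x 1 f ((derive1 f) x).
Proof.
by move=> hf x; rewrite derive1E; apply: derivableP; exact: smooth_derivable.
Qed.

Lemma smooth_derive1 D f : smooth D f -> smooth D (derive1 f).
Proof. by move=> hf n; have [_ []] := hf n.+1. Qed.

Lemma smooth_in D f : smooth D f -> D f.
Proof. by move=> /(_ 0%N)[]. Qed.

Lemma smooth_continuous D f : smooth D f -> continuous f.
Proof. by move=> hf; apply: derivable_continuous; exact: smooth_derivable. Qed.

Lemma smooth_rapid_bounded f : smooth rapid f -> smooth bounded f.
Proof. by move=> hf n; apply: smooth_upto_sub (hf n); exact: rapid_bounded. Qed.

(** These closure properties are shared by [bounded] and [rapid], so that the calculus of smooth
    functions is developed once for both. Products are taken with a bounded factor because [tanh]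
    and square roots are bounded but not rapidly decreasing. *)
Definition bounded_module D :=
  [/\ forall f g, D f -> D g -> D (f \+ g),
      forall f g, D f -> bounded g -> D (f \* g) &
      forall a f, a != 0 -> D f -> D (fun x => f (a * x))].

Lemma bounded_module_bounded : bounded_module bounded.
Proof.
by split=> [f g|f g|a f _]; [exact: boundedD|exact: boundedM|exact: bounded_dilation].
Qed.

Lemma bounded_module_rapid : bounded_module rapid.
Proof.
by split=> [f g|f g|a f]; [exact: rapidD|exact: rapidM|exact: rapid_dilation].
Qed.

Lemma smooth_uptoD D n f g : bounded_module D ->
  smooth_upto D n f -> smooth_upto D n g -> smooth_upto D n (f \+ g).
Proof.
move=> [DD _ _]; elim: n f g => [|n IH] f g.
  by move=> [Df _] [Dg _]; split => //; exact: DD.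
move=> [Df [df hf]] [Dg [dg hg]].
refine (@smooth_uptoP D n _ (derive1 f \+ derive1 g) _ _ _); [exact: DD| |exact: IH].
move=> x; rewrite /= !derive1E.
by apply: is_deriveD; exact: derivableP.
Qed.

(** Leibniz rule, by induction on the order: each of the two products in the derivative has one
    undifferentiated factor, whose order is lowered by [smooth_uptoW]. *)
Lemma smooth_uptoM D n f g : bounded_module D ->
  smooth_upto D n f -> smooth_upto bounded n g -> smooth_upto D n (f \* g).
Proof.
move=> mD; have [DD DM _] := mD; elim: n f g => [|n IH] f g.
  by move=> [Df _] [Dg _]; split => //; exact: DM.
move=> hf hg; have [Df [df hf']] := hf; have [Eg [dg hg']] := hg.
refine (@smooth_uptoP D n _ (derive1 f \* g \+ f \* derive1 g) _ _ _).
- exact: DM.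
  move=> x; rewrite /= !derive1E.
  apply: eq_is_derive (is_deriveM (derivableP (df x)) (derivableP (dg x))) _ _ => //.
  by rewrite /GRing.scale/=; ring.
by apply: smooth_uptoD => //; apply: IH => //; exact: smooth_uptoW.
Qed.

Lemma smooth_upto_cst n a : smooth_upto bounded n (cst a).
Proof.
elim: n a => [|n IH] a; first by split=> //; exists `|a|.
apply: (@smooth_uptoP _ _ _ (cst 0)) => //; by exists `|a|.
Qed.

Lemma smooth_upto_dilation D n a f : bounded_module D -> a != 0 ->
  smooth_upto D n f -> smooth_upto D n (fun x => f (a * x)).
Proof.
move=> mD a0; have [_ _ Da] := mD; elim: n f => [|n IH] f.
  by move=> [Df _]; split => //; exact: Da.
move=> [Df [df hf]].
refine (@smooth_uptoP D n _ (fun x => derive1 f (a * x) * a) _ _ _).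
- exact: Da.
  move=> x; rewrite derive1E.
  by apply: eq_is_derive
    (is_derive1_comp (derivableP (df (a * x))) (is_derive_mull a x)) _ _.
by apply: (smooth_uptoM mD _ (smooth_upto_cst n a)); exact: IH.
Qed.

Lemma smoothD D f g : bounded_module D ->
  smooth D f -> smooth D g -> smooth D (f \+ g).
Proof. by move=> mD hf hg n; apply: smooth_uptoD. Qed.

Lemma smoothM D f g : bounded_module D ->
  smooth D f -> smooth bounded g -> smooth D (f \* g).
Proof. by move=> mD hf hg n; apply: smooth_uptoM. Qed.

Lemma smooth_dilation D a f : bounded_module D -> a != 0 ->
  smooth D f -> smooth D (fun x => f (a * x)).
Proof. by move=> mD a0 hf n; apply: smooth_upto_dilation. Qed.

Lemma smooth_cst a : smooth bounded (cst a).
Proof. by move=> n; exact: smooth_upto_cst. Qed.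

Lemma smoothZ D a f : bounded_module D ->
  smooth D f -> smooth D (fun x => f x * a).
Proof. by move=> mD hf; exact: (smoothM mD hf (smooth_cst a)). Qed.

Lemma is_derive_rsqrt f x : derivable f x 1 -> 0 < f x ->
  is_derive x 1 (fun y => (Num.sqrt (f y))^-1)
    (derive1 f x * (- 2^-1) * (Num.sqrt (f x))^-1 ^+ 3).
Proof.
move=> df fx0; rewrite derive1E.
have s0 : 0 < Num.sqrt (f x) by rewrite sqrtr_gt0.
have ds := is_derive1_comp (is_derive1_sqrt fx0) (derivableP df).
have sn0 : (Num.sqrt \o f) x != 0 by rewrite /= gt_eqF.
apply: eq_is_derive (is_deriveV sn0 ds) _ _ => //=.
by rewrite /GRing.scale/=; field; rewrite gt_eqF.
Qed.

(** The function [u = f^(-1/2)] satisfies [u' = - f' u^3 / 2], a polynomial in [f'] and [u] itself,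
    so smoothness of [u] up to order [n] gives order [n.+1]. The lower bound [c] is what bounds
    [u]. *)
Lemma smooth_rsqrt f (c : R) : 0 < c -> (forall x, c <= f x) ->
  smooth bounded f -> smooth bounded (fun x => (Num.sqrt (f x))^-1).
Proof.
move=> c0 cf hf; set u : R -> R := fun x => _.
have f0 x : 0 < f x by exact: lt_le_trans (cf x).
have bu : bounded u.
  exists (Num.sqrt c)^-1 => x.
  by rewrite ger0_norm ?invr_ge0 ?sqrtr_ge0// lef_pV2 ?posrE ?sqrtr_gt0// ler_wsqrtr.
have mb := bounded_module_bounded.
elim=> [|n IH]; first by split.
refine (@smooth_uptoP bounded n u
  ((derive1 f \* cst (- 2^-1)) \* (u \* (u \* u))) bu _ _).
  move=> x.
  by refine (eq_is_derive (is_derive_rsqrt (smooth_derivable hf x) (f0 x)) _ _).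
apply: smooth_uptoM => //; last by do 2 (apply: smooth_uptoM => //).
apply: smooth_uptoM => //; last exact: smooth_upto_cst.
exact: (smooth_derive1 hf).
Qed.

Lemma derive1nS' n f : derive1n n.+1 f = derive1n n (derive1 f).
Proof. by rewrite /derive1n iterSr. Qed.

Lemma smooth_derive1n D n f : smooth D f -> smooth D (derive1n n f).
Proof.
elim: n f => [//|n IH] f hf; rewrite derive1nS'.
by apply: IH; exact: smooth_derive1.
Qed.

Lemma smooth_rapid_schwartz f : smooth rapid f -> schwartz f.
Proof.
move=> hf; split=> [n x|k n].
  exact: (smooth_derivable (smooth_derive1n n hf)).
exact: (smooth_in (smooth_derive1n n hf)).
Qed.

End SmoothClasses.

(** * The hyperbolic tangent and its derivative *)

Section Tanh.
Context {R : realType}.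
Implicit Types (x y : R) (k n : nat).

Definition tanh x := (expR (2 * x) - 1) / (expR (2 * x) + 1).

Definition sech2 x := 1 - tanh x ^+ 2.

Lemma sech2E x : sech2 x = 4 * expR (2 * x) / (expR (2 * x) + 1) ^+ 2.
Proof.
have := expR_gt0 (2 * x); rewrite /sech2 /tanh; set e := expR _ => e0.
by field; rewrite gt_eqF// addr_gt0.
Qed.

Lemma is_derive_tanh x : is_derive x 1 tanh (sech2 x).
Proof.
have de := is_derive1_comp (is_derive_expR (2 * x)) (is_derive_mull 2 x).
have dn : is_derive x 1 (fun y : R => expR (2 * y) - 1) (expR (2 * x) * 2).
  by apply: eq_is_derive (is_deriveB de (is_derive_cst (1 : R) x 1)) _ (subr0 _).
have dd : is_derive x 1 (fun y : R => expR (2 * y) + 1) (expR (2 * x) * 2).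
  by apply: eq_is_derive (is_deriveD de (is_derive_cst (1 : R) x 1)) _ (addr0 _).
have d0 : expR (2 * x) + 1 != 0 by rewrite gt_eqF// addr_gt0// expR_gt0.
have dV := @is_deriveV R (fun y : R => expR (2 * y) + 1) x _ _ d0 dd.
refine (eq_is_derive (is_deriveM dn dV) _ _) => //.
rewrite sech2E /GRing.scale/=; move: d0; set e := expR _ => e0.
by field.
Qed.

Lemma tanh_lt1 x : `|tanh x| < 1.
Proof.
rewrite /tanh; have := expR_gt0 (2 * x); set e := expR _ => e0.
have e1 : 0 < e + 1 by rewrite addr_gt0.
by rewrite ltr_norml ltr_pdivlMr// ltr_pdivrMr//; apply/andP; split; lra.
Qed.

Lemma sech2_gt0 x : 0 < sech2 x.
Proof.
rewrite sech2E divr_gt0 ?exprn_gt0 ?mulr_gt0 ?addr_gt0//.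
all: exact: expR_gt0.
Qed.

Lemma tanh_double x : tanh (2 * x) = 2 * tanh x / (1 + tanh x ^+ 2).
Proof.
rewrite /tanh [2 * (2 * x)]mulr_natl mulr2n expRD.
have := expR_gt0 (2 * x); set e := expR _ => e0.
have e1 : e + 1 != 0 by rewrite gt_eqF// addr_gt0.
have ee : e * e + 1 != 0 by rewrite gt_eqF// addr_gt0// mulr_gt0.
field; rewrite e1 /=; apply/andP; split=> //.
by rewrite gt_eqF//; have : 0 < e * e; [rewrite mulr_gt0|nra].
Qed.

Lemma tanhN x : tanh (- x) = - tanh x.
Proof.
rewrite /tanh mulrN expRN; have := expR_gt0 (2 * x); set e := expR _ => e0.
field; rewrite !gt_eqF ?addr_gt0//.
Qed.

Lemma tanh_ge0 x : 0 <= x -> 0 <= tanh x.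
Proof.
move=> x0; apply: divr_ge0; last by rewrite addr_ge0 ?expR_ge0.
by rewrite subr_ge0 -expR0 ler_expR mulr_ge0.
Qed.

(** Raise [z <= expR z], for [z = y / k.+1], to the power [k]. Dividing by [k.+1] rather than [k]
    covers [k = 0]. *)
Lemma expr_le_expR k y : 0 <= y -> y ^+ k <= k.+1%:R ^+ k * expR y.
Proof.
move=> y0; have k0 : 0 < k.+1%:R :> R by rewrite ltr0n.
rewrite -ler_pdivrMl ?exprn_gt0// mulrC -expr_div_n.
have h : y / k.+1%:R <= expR (y / k.+1%:R).
  by apply: le_trans (expR_ge1Dx _); rewrite lerDr.
apply: (@le_trans _ _ (expR (y / k.+1%:R) ^+ k)).
  by rewrite lerXn2r// ?nnegrE ?expR_ge0// divr_ge0// ltW.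
rewrite -expRM_natl ler_expR mulrA ler_pdivrMr// mulrC ler_wpM2l//.
by rewrite ler_nat.
Qed.

(** The bound [sech2 x <= 4 expR (- 2 |x|)] absorbs any power of [|x|] by [expr_le_expR]. *)
Lemma sech2_rapid : rapid sech2.
Proof.
move=> k; exists (4 * k.+1%:R ^+ k) => x.
rewrite (gtr0_norm (sech2_gt0 x)).
have xk : `|x| ^+ k <= k.+1%:R ^+ k * expR (2 * `|x|).
  apply: le_trans (@expr_le_expR k _ _); last by rewrite mulr_ge0.
  by rewrite lerXn2r// ?nnegrE// ?mulr_ge0//; have := normr_ge0 x; lra.
have s4 : sech2 x <= 4 * (expR (2 * `|x|))^-1.
  rewrite sech2E; have [x0|x0] := leP 0 x.
    rewrite ger0_norm//; have := expR_gt0 (2 * x); set e := expR _ => e0.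
    rewrite ler_pdivrMr ?exprn_gt0 ?addr_gt0// -mulrA ler_wpM2l//.
    rewrite mulrC ler_pdivlMr//; nra.
  rewrite ltr0_norm// mulrN expRN invrK.
  have := expR_gt0 (2 * x); set e := expR _ => e0.
  rewrite ler_pdivrMr ?exprn_gt0 ?addr_gt0// ler_peMr ?mulr_ge0//; first exact: ltW.
  nra.
apply: le_trans (ler_pM _ _ xk s4) _; [exact: exprn_ge0|exact/ltW/sech2_gt0|].
by rewrite mulrACA divff ?gt_eqF ?expR_gt0// mulr1 mulrC.
Qed.

Lemma is_derive_sech2 x : is_derive x 1 sech2 (sech2 x * (-2 * tanh x)).
Proof.
have dt := is_deriveM (is_derive_tanh x) (is_derive_tanh x).
refine (eq_is_derive (is_deriveB (is_derive_cst (1 : R) x 1) dt) _ _) => //.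
by rewrite /GRing.scale/=; ring.
Qed.

(** The induction is simultaneous: [tanh' = sech2], while [sech2' = - 2 sech2 tanh] involves both
    functions. *)
Lemma smooth_tanh_sech2 n : smooth_upto bounded n tanh /\ smooth_upto rapid n sech2.
Proof.
have bt : bounded tanh by exists 1 => x; exact/ltW/tanh_lt1.
elim: n => [|n [IHt IHs]]; first by split; split => //; exact: sech2_rapid.
split; first refine (@smooth_uptoP _ bounded n _ _ bt is_derive_tanh _).
  exact: smooth_upto_sub (@rapid_bounded R) IHs.
refine (@smooth_uptoP _ rapid n _ (sech2 \* (tanh \* cst (-2))) sech2_rapid _ _).
  move=> x; refine (eq_is_derive (is_derive_sech2 x) _ _) => //=.
  by rewrite [RHS]mulrCA mulrA mulrC.
have mr := @bounded_module_rapid R.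
apply: smooth_uptoM => //; apply: smooth_uptoM => //; last exact: smooth_upto_cst.
exact: bounded_module_bounded.
Qed.

Lemma smooth_tanh : smooth bounded tanh.
Proof. by move=> n; have [] := smooth_tanh_sech2 n. Qed.

Lemma smooth_sech2 : smooth rapid sech2.
Proof. by move=> n; have [] := smooth_tanh_sech2 n. Qed.

End Tanh.

(** * Integration over the real line: integrability, improper integrals, affine substitution *)

Section RealLineIntegrals.
Context {R : realType}.
Notation mu := (@lebesgue_measure R).
Implicit Types (f g F G : R -> R) (x a e l : R).

Lemma integrable_oneDsqrV :
  mu.-integrable setT (EFin \o (fun x => (oneDsqr x)^-1)).
Proof.
have mf : measurable_fun [set: R] (fun x => (oneDsqr x)^-1).
  by apply: continuous_measurable_fun; exact: continuous_oneDsqrV.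
apply/integrableP; split; first exact/measurable_EFinP.
have -> : (\int[mu]_x `|(EFin \o (fun x => (oneDsqr x)^-1)%R) x| =
    \int[mu]_x (oneDsqr x)^-1%:E)%E.
  apply: eq_integral => x _ /=.
  by rewrite ger0_norm// invr_ge0 (le_trans _ (oneDsqr_ge1 x)).
rewrite ge0_symfun_integralT.
- rewrite (_ : [set x | _] = `[0, +oo[%classic); last first.
    by apply/seteqP; split => x/=; rewrite in_itv/= andbT.
  by rewrite integral0y_oneDsqr -EFinM ltry.
- by move=> x; rewrite invr_ge0 (le_trans _ (oneDsqr_ge1 x)).
- exact: continuous_oneDsqrV.
- by move=> x /=; rewrite /oneDsqr sqrrN.
Qed.

(** Adding the decay bounds for the powers 0 and 2 gives [|f x| <= (C0 + C2) / (1 + x^2)], an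
    integrable majorant. *)
Lemma rapid_integrable f : continuous f -> rapid f ->
  mu.-integrable setT (EFin \o f).
Proof.
move=> cf rf; have [C0 h0] := rf 0%N; have [C2 h2] := rf 2%N.
apply: (le_integrable measurableT _ _
  (integrableZl measurableT (C0 + C2) integrable_oneDsqrV)).
  by apply/measurable_EFinP; exact: continuous_measurable_fun.
move=> x _ /=; rewrite lee_fin; apply: le_trans (ler_norm _).
rewrite ler_pdivlMr ?(lt_le_trans _ (oneDsqr_ge1 x))// /oneDsqr.
have := h0 x; have := h2 x; rewrite expr0 mul1r real_normK ?num_real//.
by rewrite mulrDr mulr1 [_ * x ^+ 2]mulrC => ? ?; rewrite lerD.
Qed.

(** Dominated convergence with majorant [|f|]: at each point the restrictions of [f] to [A n] are
    eventually equal to its restriction to [D]. This turns integrals over segments into improper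
    ones. *)
Lemma cvg_Rintegral_domain f (A : nat -> set R) (D : set R) :
  mu.-integrable setT (EFin \o f) ->
  (forall n, measurable (A n)) -> measurable D ->
  (forall x, \forall n \near \oo, (x \in A n) = (x \in D)) ->
  Rintegral mu (A n) f @[n --> \oo] --> Rintegral mu D f.
Proof.
move=> intf mA mD AD.
have mf : measurable_fun [set: R] f.
  by case/integrableP : intf => /measurable_EFinP.
have mfr (B : set R) : measurable B -> measurable_fun [set: R] (f \_ B).
  by move=> mB; apply/(measurable_restrictT _ _).1 => //; exact: measurable_funTS.
have intD : mu.-integrable setT (EFin \o (f \_ D)).
  rewrite -restrict_EFin; apply/integrable_restrict => //.
  by rewrite setTI; exact: integrableS intf.
have -> : (fun n => Rintegral mu (A n) f) =
    fine \o (fun n => \int[mu]_x (EFin (f \_ (A n) x)))%E.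
  by apply/funext => n /=; rewrite Rintegral_mkcond.
rewrite Rintegral_mkcond; apply: fine_cvg.
rewrite /Rintegral fineK; last exact: integrable_fin_num.
apply: (@dominated_cvg _ _ _ mu setT measurableT (fun n => EFin \o (f \_ (A n)))
  (EFin \o (f \_ D)) (fun x => `|f x|%:E)) => //.
- by move=> n; apply/measurable_EFinP; exact: mfr.
- move=> x _; apply: cvg_near_cst; near=> n; rewrite /= !patchE.
  by have -> : (x \in A n) = (x \in D) by near: n; exact: AD.
- exact: integrable_abse intf.
- move=> n x _; rewrite /= patchE lee_fin.
  by case: ifP => // _; rewrite normr0.
Unshelve. all: by end_near. Qed.

Lemma Rintegral_FTC2 F f a b : (forall x, is_derive x 1 F (f x)) ->
  continuous f -> a < b -> Rintegral mu `[a, b] f = F b - F a.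
Proof.
move=> dF cf ab; have cF := is_derive_continuous dF.
rewrite /Rintegral (@continuous_FTC2 _ f F)//.
- exact: continuous_subspaceT.
- split; first by move=> x _; have := dF x => /@ex_derive.
  + exact/cvg_at_right_filter/cF.
  + exact/cvg_at_left_filter/cF.
- by move=> x _; exact: is_derive_derive1.
Qed.

Lemma Rintegral_FTC2_itvNyc F f l x : (forall x, is_derive x 1 F (f x)) ->
  continuous f -> mu.-integrable setT (EFin \o f) ->
  F (- n%:R) @[n --> \oo] --> l -> Rintegral mu `]-oo, x] f = F x - l.
Proof.
move=> dF cf intf Fl.
have h : Rintegral mu `[- n%:R, x] f @[n --> \oo] --> Rintegral mu `]-oo, x] f.
  apply: cvg_Rintegral_domain => // y; near=> n.
  rewrite !mem_setE !in_itv/=; suff -> : - n%:R <= y by [].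
  rewrite lerNl; near: n; exact: nbhs_infty_ger.
have h' : Rintegral mu `[- n%:R, x] f @[n --> \oo] --> F x - l.
  apply: cvg_trans (cvgB (cvg_cst (F x)) Fl); apply: near_eq_cvg.
  near=> n; rewrite (Rintegral_FTC2 dF)// ltrNl.
  near: n; exact: nbhs_infty_gtr.
exact: cvg_unique h h'.
Unshelve. all: by end_near. Qed.

Lemma Rintegral_FTC2_setT F f l r : (forall x, is_derive x 1 F (f x)) ->
  continuous f -> mu.-integrable setT (EFin \o f) ->
  F (- n%:R) @[n --> \oo] --> l -> F n%:R @[n --> \oo] --> r ->
  Rintegral mu setT f = r - l.
Proof.
move=> dF cf intf Fl Fr.
have h : Rintegral mu `]-oo, n%:R] f @[n --> \oo] --> Rintegral mu setT f.
  apply: cvg_Rintegral_domain => // y; near=> n.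
  rewrite in_setT mem_setE in_itv/=; near: n; exact: nbhs_infty_ger.
have h' : Rintegral mu `]-oo, n%:R] f @[n --> \oo] --> r - l.
  have -> : (fun n : nat => Rintegral mu `]-oo, n%:R] f) = (fun n => F n%:R - l).
    by apply/funext => n; exact: Rintegral_FTC2_itvNyc.
  exact: cvgB Fr (cvg_cst l).
exact: cvg_unique h h'.
Unshelve. all: by end_near. Qed.

(** The substitution rule for an increasing map is applied to nonnegative integrands, namely the
    positive and negative parts of [G]; hence no integrability of [G] is required. *)
Lemma integral_affine_substitution G a e : 0 < e -> continuous G ->
  (\int[mu]_x (G ((x - a) / e) / e)%:E = \int[mu]_x (G x)%:E)%E.
Proof.
move=> e0 cG.
pose L x := (x - a) / e.
have dL x : is_derive x 1 L e^-1.
  refine (eq_is_derive (is_deriveZ e^-1 (is_deriveB (is_derive_id x (1 : R))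
    (is_derive_cst a x 1))) _ _).
    by move=> y; rewrite /L mulrC.
  by rewrite /GRing.scale/= subr0 mulr1.
have L1 : derive1 L = cst e^-1.
  by apply/funext => x; exact: is_derive_derive1.
have pos (H : R -> R) : continuous H -> (forall x, 0 <= H x) ->
    (\int[mu]_x (H (L x) / e)%:E = \int[mu]_x (H x)%:E)%E.
  move=> cH H0; rewrite (@increasing_ge0_integration_by_substitutionT _ L H)//.
  - by apply: eq_integral => x _; rewrite L1.
  - by move=> x y xy; rewrite /L ltr_pM2r ?invr_gt0// ltrD2r.
  - by rewrite L1; move=> x; exact: cvg_cst.
  - by rewrite L1; exact: is_cvg_cst.
  - by rewrite L1; exact: is_cvg_cst.
  - apply: gt0_cvgMlNy; first by rewrite invr_gt0.
    apply/cvgrNyPle => A; near=> x; rewrite lerBlDr.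
    by near: x; apply: nbhs_ninfty_le; rewrite num_real.
  - apply: gt0_cvgMly; first by rewrite invr_gt0.
    apply/cvgryPge => A; near=> x; rewrite lerBrDr.
    by near: x; apply: nbhs_pinfty_ge; rewrite num_real.
have posmax (H : R -> R) : continuous H ->
    (\int[mu]_x (Num.max (H (L x) / e) 0)%:E = \int[mu]_x (Num.max (H x) 0)%:E)%E.
  move=> cH; rewrite -(pos (fun x => Num.max (H x) 0)).
  - apply: eq_integral => x _; congr EFin.
    by rewrite -{1}(mul0r e^-1) maxr_pMl// invr_ge0 ltW.
  - by move=> x; apply: continuous_max; [exact: cH|exact: cvg_cst].
  - by move=> x; rewrite le_max lexx orbT.
rewrite integralE [RHS]integralE; congr (_ - _)%E.
- transitivity (\int[mu]_x (Num.max (G (L x) / e)%R 0%R)%:E)%E.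
    by apply: eq_integral => x _; rewrite funeposE -EFin_max.
  rewrite posmax//; apply: eq_integral => x _.
  by rewrite funeposE -EFin_max.
- transitivity (\int[mu]_x (Num.max (- G (L x) / e)%R 0%R)%:E)%E.
    by apply: eq_integral => x _; rewrite funenegE mulNr -EFin_max.
  rewrite (posmax (fun x => - G x)); last by move=> x; apply: cvgN; exact: cG.
  by apply: eq_integral => x _; rewrite funenegE -EFin_max.
Unshelve. all: by end_near. Qed.

Lemma Rintegral_affine_substitution G a e : 0 < e -> continuous G ->
  Rintegral mu setT (fun x => G ((x - a) / e) / e) = Rintegral mu setT G.
Proof. by move=> e0 cG; rewrite /Rintegral integral_affine_substitution. Qed.

End RealLineIntegrals.

(** * Construction of squared profiles whose derivative has vanishing moments *)

Section MomentFreeProfiles.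
Context {R : realType}.
Notation mu := (@lebesgue_measure R).
Implicit Types (f g p : R -> R) (x a c : R) (k n l : nat).

Let mb := @bounded_module_bounded R.
Let mr := @bounded_module_rapid R.

Definition moment k g := Rintegral mu setT (fun x => x ^+ k * g x).

Lemma smooth_moment_integrable k g : smooth rapid g ->
  mu.-integrable setT (EFin \o (fun x => x ^+ k * g x)).
Proof.
move=> sg; apply: rapid_integrable; last exact: rapidX (smooth_in sg).
move=> x; apply: cvgM; first exact: exprn_continuous.
exact: smooth_continuous sg x.
Qed.

Lemma smooth_dilationZ a g : a != 0 -> smooth rapid g ->
  smooth rapid (fun x => g (a * x) * a).
Proof. by move=> a0 sg; apply: smoothZ => //; exact: smooth_dilation. Qed.

Lemma moment_dilation k a g : 0 < a -> smooth rapid g ->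
  moment k (fun x => g (a * x) * a) = a ^- k * moment k g.
Proof.
move=> a0 sg; have an0 : a != 0 by rewrite gt_eqF.
have ak : a ^+ k != 0 by rewrite expf_neq0.
have cG : continuous (fun x => x ^+ k * g x).
  move=> x; apply: cvgM; first exact: exprn_continuous.
  exact: smooth_continuous sg x.
apply: (mulfI ak); rewrite mulrA divff// mul1r /moment.
have ai : 0 < a^-1 by rewrite invr_gt0.
rewrite -(Rintegral_affine_substitution 0 ai cG) -RintegralZl//.
  by apply: eq_Rintegral => x _; rewrite subr0 invrK exprMn [x * a]mulrC; ring.
exact: smooth_moment_integrable (smooth_dilationZ an0 sg).
Qed.

Lemma rapid_cvg0 f : rapid f ->
  f n%:R @[n --> \oo] --> (0 : R) /\ f (- n%:R) @[n --> \oo] --> (0 : R).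
Proof.
move=> /(_ 1%N)[C hC].
suff h (s : nat -> R) : (forall n, `|s n| = n%:R) -> f (s n) @[n --> \oo] --> (0 : R).
  by split; apply: h => n; rewrite ?normrN ger0_norm.
move=> sn; apply/cvgrPdist_le => e e0; near=> n.
have n0 : 0 < n%:R :> R by near: n; exact: nbhs_infty_gtr.
rewrite sub0r normrN -(ler_pM2l n0).
apply: (@le_trans _ _ C); first by have := hC (s n); rewrite expr1 sn.
rewrite -ler_pdivrMr//; near: n; exact: nbhs_infty_ger.
Unshelve. all: by end_near. Qed.

(** For [l = 1] and [t = tanh x], the doubling formula gives the ratio [4 / (1 + t^2)^2 = 1 + (1 -
    t^2) (3 + t^2) / (1 + t^2)^2], whose last term is [sech2] times a bounded smooth function. The
    general case iterates the doubling and multiplies the ratios. *)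
Lemma tanh_pow2_ratio l : exists r : R -> R,
  [/\ smooth rapid r, (forall x, 0 <= r x) &
      forall x, tanh (2 ^+ l * x) ^+ 2 = tanh x ^+ 2 * (1 + r x)].
Proof.
have bq : smooth bounded (cst (1 : R) \+ tanh \* tanh).
  by apply: smoothD => //; [exact: smooth_cst|apply: smoothM => //; exact: smooth_tanh].
have q1 x : (1 : R) <= (cst (1 : R) \+ tanh \* tanh) x.
  by rewrite /= lerDl -expr2 sqr_ge0.
have su := smooth_rsqrt ltr01 q1 bq.
(* Here [u = (1 + tanh^2)^(-1/2)]; its fourth power supplies the denominator [(1 + tanh^2)^2]. *)
set u := (fun x => _) in su.
have u4 x : u x ^+ 4 = (1 + tanh x ^+ 2) ^- 2.
  rewrite /u exprVn -[4%N]/(2 * 2)%N exprM sqr_sqrtr ?expr2//.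
  exact: le_trans (q1 x).
pose r1 := sech2 \* ((cst (3 : R) \+ tanh \* tanh) \* ((u \* u) \* (u \* u))).
have sr1 : smooth rapid r1.
  apply: smoothM => //; first exact: smooth_sech2.
  apply: smoothM => //; last by do 2 apply: smoothM => //.
  by apply: smoothD => //; [exact: smooth_cst|apply: smoothM => //; exact: smooth_tanh].
have r10 x : 0 <= r1 x.
  rewrite /r1 /= mulr_ge0//; first exact/ltW/sech2_gt0.
  by rewrite mulr_ge0 -?expr2 ?sqr_ge0// addr_ge0 ?sqr_ge0.
have r1E x : tanh (2 * x) ^+ 2 = tanh x ^+ 2 * (1 + r1 x).
  rewrite tanh_double /r1 /sech2 /= -!expr2 -exprM u4.
  have t1 : 1 + tanh x ^+ 2 != 0 by rewrite gt_eqF// ltr_wpDr ?sqr_ge0.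
  by field.
clearbody r1.
elim: l => [|l [r [sr r0 rE]]].
  exists (cst 0); split => [|//|x].
    have -> : cst 0 = (fun x => sech2 x * 0) by apply/funext => x; rewrite mulr0.
    by apply: smoothZ => //; exact: smooth_sech2.
  by rewrite expr0 mul1r addr0 mulr1.
have l0 : 2 ^+ l != 0 :> R by rewrite expf_neq0.
have srl : smooth rapid (fun x => r1 (2 ^+ l * x)) by exact: smooth_dilation.
exists ((r \+ (fun x => r1 (2 ^+ l * x))) \+ (r \* (fun x => r1 (2 ^+ l * x)))).
split=> [|x|x].
- apply: smoothD => //; first exact: smoothD.
  by apply: smoothM => //; exact: smooth_rapid_bounded.
- by rewrite /= addr_ge0// ?addr_ge0// mulr_ge0.
- have -> : 2 ^+ l.+1 * x = 2 * (2 ^+ l * x) by rewrite exprS mulrA.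
  rewrite (r1E (2 ^+ l * x)) (rE x) /=; move: (r x) (r1 _) (tanh x) => a b t.
  by ring.
Qed.

(** [squared_profile p] is [V ^+ 2] for the shock profile
    [V = tanh * sqrt (1 + p)], which changes sign only at [0]. *)
Definition squared_profile p x := tanh x ^+ 2 * (1 + p x).

Lemma smooth_squared_profileB1 p : smooth rapid p ->
  smooth rapid (fun x => squared_profile p x - 1).
Proof.
move=> sp; have -> : (fun x => squared_profile p x - 1) =
    (fun x => sech2 x * -1) \+ (p \* (tanh \* tanh)).
  by apply/funext => x; rewrite /squared_profile /sech2 /=; ring.
apply: smoothD => //; first by apply: smoothZ => //; exact: smooth_sech2.
by apply: smoothM => //; apply: smoothM => //; exact: smooth_tanh.
Qed.

Lemma derive1_squared_profile p : smooth rapid p ->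
  smooth rapid (derive1 (squared_profile p)) /\
  forall x, is_derive x 1 (squared_profile p) (derive1 (squared_profile p) x).
Proof.
move=> /smooth_squared_profileB1 sw.
have dw x : is_derive x 1 (squared_profile p)
    (derive1 (fun x => squared_profile p x - 1) x).
  refine (eq_is_derive (is_deriveD (smooth_is_derive sw x)
    (is_derive_cst (1 : R) x 1)) _ (addr0 _)).
  by move=> y; rewrite /GRing.add/= /cst subrK.
have e : derive1 (squared_profile p) = derive1 (fun x => squared_profile p x - 1).
  by apply/funext => x; exact: is_derive_derive1.
by rewrite e; split=> //; exact: smooth_derive1.
Qed.

(** The squared profile tends to 1 at both ends, so its total increment is zero. This is the base
    case of the cancellation of moments. *)
Lemma moment0_squared_profile p : smooth rapid p ->
  moment 0 (derive1 (squared_profile p)) = 0.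
Proof.
move=> sp; have [sd dw] := derive1_squared_profile sp.
have [lp ln] := rapid_cvg0 (smooth_in (smooth_squared_profileB1 sp)).
have -> : moment 0 (derive1 (squared_profile p)) =
    Rintegral mu setT (derive1 (squared_profile p)).
  by rewrite /moment; apply: eq_Rintegral => x _; rewrite expr0 mul1r.
rewrite (Rintegral_FTC2_setT dw _ _ (l := 1) (r := 1)) ?subrr//.
- exact: smooth_continuous sd.
- by apply: rapid_integrable; [exact: smooth_continuous sd|exact: smooth_in sd].
- exact/subr_cvg0/ln.
- exact/subr_cvg0/lp.
Qed.

(** The uniform lower bound allows a smooth square root of [1 + p] to be taken, and leaves room for
    the subtraction in the next construction. *)
Definition flat_profile n p :=
  [/\ smooth rapid p, (exists2 c, 0 < c & forall x, c <= 1 + p x) &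
      forall k, (k <= n)%N -> moment k (derive1 (squared_profile p)) = 0].

(** With [W = squared_profile p], the new profile is
    [(W (L x) - L ^- n.+1 * W x) / (1 - L ^- n.+1)]: the [k]-th moment of the
    derivative is multiplied by a constant which vanishes for [k = n.+1].
    Taking [L] large keeps [1 + q] bounded away from [0], and [L = 2 ^+ l] makes
    the factor [(tanh (L x) / tanh x) ^+ 2] a smooth function of [tanh]. *)
Lemma flat_profileS n p : flat_profile n p -> exists q, flat_profile n.+1 q.
Proof.
move=> [sp [c c0 cp] mp].
have [C hC] := rapid_bounded (smooth_in sp).
have pC x : 1 + p x <= 1 + C by rewrite lerD2l (le_trans (ler_norm _)).
(* [B] bounds every quotient of two values of [1 + p]. Since [m <= L^-1], the choice [L > B] yields
   [m * (1 + C) < c], which keeps [1 + q] above a positive constant. *)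
pose B := (1 + C) / c; have B1 : 1 <= B.
  by rewrite ler_pdivlMr// mul1r (le_trans (cp 0)).
pose l := Num.bound B; pose L : R := 2 ^+ l.
have BL : B < L.
  apply: lt_le_trans (archi_boundP (le_trans ler01 B1)) _.
  by rewrite /L -natrX ler_nat ltnW// ltn_expl.
have L1 : 1 < L by exact: le_lt_trans BL.
have L0 : 0 < L by exact: lt_trans L1.
pose m := L ^- n.+1.
have mL : m <= L^-1.
  rewrite /m lef_pV2 ?posrE ?exprn_gt0// exprS ler_peMr ?(ltW L0)//.
  exact/exprn_ege1/ltW.
have m0 : 0 < m by rewrite invr_gt0 exprn_gt0.
have m1 : m < 1 by rewrite (le_lt_trans mL)// invf_lt1.
have mB : m * (1 + C) < c.
  have Cc : 1 + C < c * L by rewrite mulrC -ltr_pdivrMr.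
  have C0 : 0 < 1 + C by exact: lt_le_trans c0 (le_trans (cp 0) (pC 0)).
  apply: le_lt_trans (ler_wpM2r (ltW C0) mL) _.
  by rewrite mulrC ltr_pdivrMr.
have d0 : 0 < 1 - m by rewrite subr_gt0.
have [r [sr r0 rE]] := tanh_pow2_ratio l; rewrite -/L in rE.
pose pL x := p (L * x).
have Ln0 : L != 0 by rewrite gt_eqF.
have spL : smooth rapid pL by exact: smooth_dilation.
(* Obtained by solving [wE] for [q]: dividing by [1 - m] makes the constant terms cancel, so only
   rapidly decreasing terms remain. *)
pose q x := (r x + pL x + r x * pL x + p x * (- m)) * (1 - m)^-1.
have sq : smooth rapid q.
  apply: smoothZ => //.
  apply: (@smoothD _ rapid ((r \+ pL) \+ (r \* pL)) (fun x => p x * - m)) => //.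
    apply: smoothD => //; first exact: smoothD.
    by apply: smoothM => //; exact: smooth_rapid_bounded.
  exact: smoothZ.
have qE x : 1 + q x = ((1 + r x) * (1 + p (L * x)) - m * (1 + p x)) / (1 - m).
  by rewrite /q /pL; field; rewrite gt_eqF.
have wE x : squared_profile q x =
    (squared_profile p (L * x) - m * squared_profile p x) / (1 - m).
  by rewrite /squared_profile qE rE; field; rewrite gt_eqF.
exists q; split=> //.
- exists ((c - m * (1 + C)) / (1 - m)); first by rewrite divr_gt0 ?subr_gt0.
  move=> x; rewrite qE ler_pM2r ?invr_gt0// lerB//.
    apply: le_trans (cp (L * x)) _; rewrite ler_peMl ?lerDl//.
    exact: le_trans (ltW c0) (cp _).
  by rewrite ler_pM2l.
have [sd dw] := derive1_squared_profile sp.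
set g := derive1 _ in sd dw mp.
have gE : derive1 (squared_profile q) =
    fun x => (1 - m)^-1 * (g (L * x) * L + (- m) * g x).
  apply/funext => x.
  have d1 := is_derive1_comp (dw (L * x)) (is_derive_mull L x).
  have d2 := is_deriveZ (1 - m)^-1 (is_deriveD d1 (is_deriveZ (- m) (dw x))).
  suff d3 : is_derive x 1 (squared_profile q)
      ((1 - m)^-1 * (g (L * x) * L + (- m) * g x)) by exact: is_derive_derive1.
  by refine (eq_is_derive d2 _ _) => // y; rewrite wE mulrC -mulNr.
move=> k; rewrite leq_eqVlt => kn.
have sgL := smooth_dilationZ Ln0 sd.
have -> : moment k (derive1 (squared_profile q)) =
    (1 - m)^-1 * (L ^- k * moment k g + (- m) * moment k g).
  rewrite -(moment_dilation _ L0 sd) /moment gE.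
  have i1 := smooth_moment_integrable k sgL.
  have i2 := smooth_moment_integrable k sd.
  have i3 := integrableZl measurableT (- m) i2.
  rewrite -[X in _ = _ * (_ + X)]RintegralZl// -RintegralD// -RintegralZl//.
    by apply: eq_Rintegral => x _; ring.
  exact: (integrableD measurableT i1 i3).
case/predU1P : kn => [->|]; first by rewrite -mulrDl subrr mul0r mulr0.
by rewrite ltnS => /mp ->; rewrite !mulr0 addr0 mulr0.
Qed.

Lemma flat_profile_exists n : exists p, flat_profile n p.
Proof.
elim: n => [|n [p /flat_profileS//]].
(* The starting point is [p = 0], that is [tanh ^+ 2]; writing zero as a multiple of [sech2] gives
   its smoothness from [smoothZ]. *)
have s0 : smooth rapid (fun x : R => sech2 x * 0).
  by apply: smoothZ => //; exact: smooth_sech2.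
exists (fun x => sech2 x * 0); split=> //.
  by exists 1 => // x; rewrite mulr0 addr0.
by move=> k; rewrite leqn0 => /eqP ->; exact: moment0_squared_profile.
Qed.

End MomentFreeProfiles.

(** * From the squared profile to the shock profile itself *)

Section ShockProfile.
Context {R : realType}.
Notation mu := (@lebesgue_measure R).
Implicit Types (f g p : R -> R) (x a c : R) (k n : nat).

Let mb := @bounded_module_bounded R.
Let mr := @bounded_module_rapid R.

Lemma cvg_norm_le0 (a b : nat -> R) : (forall n, `|a n| <= `|b n|) ->
  b @ \oo --> (0 : R) -> a @ \oo --> (0 : R).
Proof.
move=> ab b0; apply/cvgrPdist_le => e e0.
near=> n; rewrite sub0r normrN (le_trans (ab n))//.
near: n; exact: cvgr0_norm_le.
Unshelve. all: by end_near. Qed.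

(** For a flat profile [p], put [V = tanh * sqrt (1 + p)], [K = (V + 1) / 2] and [theta = V' / 2].
    Then [theta * (K - 1/2) = V V' / 4 = (V^2)' / 8], which inherits the vanishing moments. *)
Lemma shock_profile n : exists K theta : R -> R,
  [/\ smooth rapid theta /\ (forall x, is_derive x 1 K (theta x)),
      K (- m%:R) @[m --> \oo] --> (0 : R) /\ K m%:R @[m --> \oo] --> (1 : R),
      smooth rapid (fun x => theta x * (K x - 2^-1)) &
      forall k, (k <= n)%N -> moment k (fun x => theta x * (K x - 2^-1)) = 0].
Proof.
have [p [sp [c c0 cp] mp]] := flat_profile_exists (R := R) n.
have [sw dw] := derive1_squared_profile sp.
pose q x := 1 + p x; have q0 x : 0 < q x by exact: lt_le_trans (cp x).
have sq : smooth bounded q.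
  apply: (@smoothD _ bounded (cst 1) p) => //; first exact: smooth_cst.
  exact: smooth_rapid_bounded.
have su := smooth_rsqrt c0 cp sq.
set u := (fun x => _) in su.
pose S x := Num.sqrt (q x).
have S0 x : 0 < S x by rewrite sqrtr_gt0.
have S2 x : S x ^+ 2 = q x by rewrite sqr_sqrtr// ltW.
(* The root is handled through its reciprocal [u]: [S = q * u], a product of functions already known
   to be smooth. *)
have sS : smooth bounded S.
  have -> : S = q \* u.
    by apply/funext => x; rewrite /u /= -/(S x) -S2; field; rewrite gt_eqF.
  exact: smoothM.
pose V x := tanh x * S x.
have V2 x : V x ^+ 2 = squared_profile p x by rewrite exprMn S2.
pose dV x := sech2 x * S x + derive1 p x * (tanh x * (u x * 2^-1)).
have VdV x : is_derive x 1 V (dV x).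
  have dq : is_derive x 1 q (derive1 p x).
    by refine (eq_is_derive (is_deriveD (is_derive_cst (1 : R) x 1)
      (smooth_is_derive sp x)) _ (add0r _)).
  have dS := is_derive1_comp (is_derive1_sqrt (q0 x)) dq.
  refine (eq_is_derive (is_deriveM (is_derive_tanh x) dS) _ _) => //.
  rewrite /dV /u /GRing.scale/= -/(q x) -/(S x).
  by field; rewrite gt_eqF.
have sdV : smooth rapid dV.
  apply: (@smoothD _ rapid (sech2 \* S) (derive1 p \* (tanh \* (u \* cst 2^-1)))) => //.
    by apply: smoothM => //; exact: smooth_sech2.
  apply: smoothM => //; first exact: smooth_derive1 sp.
  apply: smoothM => //; first exact: smooth_tanh.
  by apply: smoothM => //; exact: smooth_cst.
have [Wp Wn] := rapid_cvg0 (smooth_in (smooth_squared_profileB1 sp)).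
(* The limit of [V^2] fixes that of [V] only up to sign. Since [V >= 0] on the right half-line,
   [V + 1 >= 1] and [|V - 1| <= |V^2 - 1|]; the left end is symmetric, with [V <= 0]. *)
have Vp : V m%:R - 1 @[m --> \oo] --> (0 : R).
  apply: cvg_norm_le0 Wp => m; rewrite -V2.
  have V0 : 0 <= V m%:R by rewrite mulr_ge0 ?tanh_ge0// ltW.
  have -> : V m%:R ^+ 2 - 1 = (V m%:R - 1) * (V m%:R + 1) by ring.
  by rewrite normrM ler_peMr// ger0_norm ?lerDr// addr_ge0.
have Vn : V (- m%:R) + 1 @[m --> \oo] --> (0 : R).
  apply: cvg_norm_le0 Wn => m; rewrite -V2.
  have V0 : 0 <= - V (- m%:R).
    by rewrite /V tanhN mulNr opprK mulr_ge0 ?tanh_ge0// ltW.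
  have -> : V (- m%:R) ^+ 2 - 1 = (V (- m%:R) + 1) * - (- V (- m%:R) + 1) by ring.
  by rewrite normrM ler_peMr// normrN ger0_norm ?lerDr// addr_ge0.
pose K x := (V x + 1) * 2^-1; pose theta x := dV x * 2^-1.
have gE : (fun x => theta x * (K x - 2^-1)) =
    fun x => derive1 (squared_profile p) x * 8^-1.
  apply/funext => x.
  have d2 : is_derive x 1 (squared_profile p) (2 * (V x * dV x)).
    refine (eq_is_derive (is_deriveM (VdV x) (VdV x)) _ _).
      by move=> y; rewrite -V2.
    by rewrite /GRing.scale/=; ring.
  by rewrite (is_derive_derive1 d2) /theta /K; field.
exists K, theta; rewrite gE; split.
- split; first exact: smoothZ.
  move=> x; refine (eq_is_derive (is_deriveZ 2^-1
    (is_deriveD (VdV x) (is_derive_cst (1 : R) x 1))) _ _).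
    by move=> y; rewrite /K mulrC.
  by rewrite /GRing.scale/= addr0 mulrC.
- split; first by have := cvgM Vn (cvg_cst (2^-1 : R)); rewrite mul0r; exact.
  apply/subr_cvg0.
  have -> : (fun m : nat => K m%:R - 1) = fun m : nat => (V m%:R - 1) * 2^-1.
    by apply/funext => m; rewrite /K; field.
  by have := cvgM Vp (cvg_cst (2^-1 : R)); rewrite mul0r; exact.
- exact: smoothZ.
move=> k kn; rewrite -[RHS](mul0r (8^-1 : R)) -(mp k kn) /moment -RintegralZr//.
  by apply: eq_Rintegral => x _; rewrite mulrA.
exact: smooth_moment_integrable.
Qed.

End ShockProfile.

(** * Taylor expansion of the pairing and orders in [e] *)

Section Asymptotics.
Context {R : realType}.
Notation mu := (@lebesgue_measure R).
Implicit Types (f g psi : R -> R) (x b h e C : R) (k n M : nat).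

(** The mean value theorem writes [f h] as [df x * h] with [|x| <= |h|]. The factor [1 / M.+1] that
    integration would give is dropped, as only the order matters. *)
Lemma MVT_norm_le (f df : R -> R) C M : (forall x, is_derive x 1 f (df x)) ->
  f 0 = 0 -> (forall x, `|df x| <= C * `|x| ^+ M) ->
  forall h, `|f h| <= C * `|h| ^+ M.+1.
Proof.
move=> dF f0 hdf h; have cf := is_derive_continuous dF.
have C0 : 0 <= C.
  by have := hdf 1; rewrite normr1 expr1n mulr1; exact: le_trans.
have bnd x : `|x| <= `|h| -> `|df x * h| <= C * `|h| ^+ M.+1.
  move=> xh; rewrite normrM exprSr mulrA ler_wpM2r// (le_trans (hdf x))//.
  by rewrite ler_wpM2l// lerXn2r// nnegrE.
have [h0|/ltW h0] := leP 0 h.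
  have [x xI] := MVT_segment h0 (fun x _ => dF x) (continuous_subspaceT cf).
  rewrite f0 !subr0 => ->; apply: bnd.
  by move: xI; rewrite in_itv/= => /andP[x0 xh]; rewrite !ger0_norm.
have [x xI] := MVT_segment h0 (fun x _ => dF x) (continuous_subspaceT cf).
rewrite f0 !sub0r mulrN => /oppr_inj ->; apply: bnd.
by move: xI; rewrite in_itv/= => /andP[hx x0]; rewrite !ler0_norm// lerN2.
Qed.

Lemma is_derive_taylor_poly (a : nat -> R) M x :
  is_derive x 1 (fun h => \sum_(k < M.+1) a k / k`!%:R * h ^+ k)
    (\sum_(k < M) a k.+1 / k`!%:R * x ^+ k).
Proof.
elim: M => [|M IH].
  refine (eq_is_derive (is_derive_cst (a 0%N) x 1) _ _); last by rewrite big_ord0.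
  by move=> y; rewrite big_ord1 divr1 mulr1.
have dX := is_deriveX M.+1 (is_derive_id x (1 : R)).
rewrite exprfctE in dX.
have dZ := is_deriveZ (a M.+1 / M.+1`!%:R) dX.
refine (eq_is_derive (is_deriveD IH dZ) _ _).
  by move=> y; rewrite [in RHS]big_ord_recr.
rewrite [in RHS]big_ord_recr/= /GRing.scale/= factS natrM; congr (_ + _).
by field; rewrite nat1r !pnatr_eq0 -lt0n fact_gt0.
Qed.

(** By induction on [M]: the derivative in [h] of the remainder of [psi] is the remainder of [psi']
    one order lower, and the remainder vanishes at [h = 0], so [MVT_norm_le] applies. *)
Lemma taylor_bound psi C M :
  (forall n x, derivable (derive1n n psi) x 1) ->
  (forall x, `|derive1n M psi x| <= C) ->
  forall b h, `|psi (b + h) - \sum_(k < M) derive1n k psi b / k`!%:R * h ^+ k|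
    <= C * `|h| ^+ M.
Proof.
elim: M psi => [|M IH] psi dpsi hC b h.
  by rewrite big_ord0 subr0 expr0 mulr1; exact: hC.
have hC' x : `|derive1n M (derive1 psi) x| <= C by rewrite -derive1nS'.
have dpsi' n x : derivable (derive1n n (derive1 psi)) x 1 by rewrite -derive1nS'.
pose f h := psi (b + h) - \sum_(k < M.+1) derive1n k psi b / k`!%:R * h ^+ k.
apply: (@MVT_norm_le f (fun h => derive1 psi (b + h) -
  \sum_(k < M) derive1n k (derive1 psi) b / k`!%:R * h ^+ k)).
- move=> x; have db : is_derive x 1 (fun h : R => b + h) 1.
    by refine (eq_is_derive (is_deriveD (is_derive_cst b x 1)
      (is_derive_id x (1 : R))) _ (add0r _)).
  have d1 := is_derive1_comp (derivableP (dpsi 0%N (b + x))) db.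
  have d2 := is_derive_taylor_poly (fun k => derive1n k psi b) M x.
  refine (eq_is_derive (is_deriveB d1 d2) _ _) => //.
  rewrite mulr1 -derive1E; congr (_ - _).
  by apply: eq_bigr => k _; rewrite derive1nS'.
- rewrite /f addr0 big_ord_recl /= expr0 mulr1 divr1 big1 ?addr0 ?subrr//.
  by move=> i _; rewrite expr0n mulr0.
- by move=> x; exact: IH.
Qed.

Lemma Rintegral_mul_poly g (a : nat -> R) M : smooth rapid g ->
  mu.-integrable setT (EFin \o (fun x => g x * \sum_(k < M) a k * x ^+ k)) /\
  Rintegral mu setT (fun x => g x * \sum_(k < M) a k * x ^+ k) =
    \sum_(k < M) a k * moment k g.
Proof.
move=> sg; elim: M => [|M [IH1 IH2]].
  have -> : (fun x => g x * \sum_(k < 0) a k * x ^+ k) = cst 0.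
    by apply/funext => x; rewrite big_ord0 mulr0.
  by rewrite big_ord0 Rintegral_cst// mul0r; split=> //; exact: integrable0.
have -> : (fun x => g x * \sum_(k < M.+1) a k * x ^+ k) =
    fun x => g x * (\sum_(k < M) a k * x ^+ k) + a M * (x ^+ M * g x).
  by apply/funext => x; rewrite big_ord_recr/=; ring.
have i1 := smooth_moment_integrable M sg.
have i2 := integrableZl measurableT (a M) i1.
split; first exact: (integrableD measurableT IH1 i2).
by rewrite RintegralD// IH2 RintegralZl// big_ord_recr.
Qed.

Lemma schwartz_bounded psi n : schwartz psi -> bounded (derive1n n psi).
Proof.
by move=> [_ /(_ 0%N n)[C hC]]; exists C => x; have := hC x; rewrite expr0 mul1r.
Qed.

(** Expand [psi] at [b] with increment [e * y]. The Taylor remainder is at most [C |e y|^M], and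
    integrating it against [|g|] leaves [e^M] times [C * A], where [A] is an absolute moment
    independent of [e]. *)
Lemma moment_expansion g psi b M : smooth rapid g -> schwartz psi ->
  exists C, forall e, 0 < e ->
    `|Rintegral mu setT (fun y => g y * psi (b + e * y)) -
      \sum_(k < M) derive1n k psi b / k`!%:R * moment k g * e ^+ k| <= C * e ^+ M.
Proof.
move=> sg spsi; have [dpsi _] := spsi.
have [C hC] := schwartz_bounded M spsi.
pose A := Rintegral mu setT (fun y => `|y ^+ M * g y|).
exists (C * A) => e e0.
have cpsi := derivable_continuous (dpsi 0%N).
have cpe : continuous (fun y => psi (b + e * y)).
  move=> y; apply: continuous_comp; last exact: cpsi.
  apply: cvgD; first exact: cvg_cst.
  by apply: cvgM; [exact: cvg_cst|exact: cvg_id].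
have ige : mu.-integrable setT (EFin \o (fun y => g y * psi (b + e * y))).
  apply: rapid_integrable.
    by move=> y; apply: cvgM; [exact: smooth_continuous sg y|exact: cpe].
  apply: (rapidM (smooth_in sg)).
  by have [E hE] := schwartz_bounded 0 spsi; exists E => x; exact: hE.
have [ip <-] : mu.-integrable setT (EFin \o (fun y => g y *
      \sum_(k < M) (derive1n k psi b / k`!%:R * e ^+ k) * y ^+ k)) /\
    Rintegral mu setT (fun y => g y *
      \sum_(k < M) (derive1n k psi b / k`!%:R * e ^+ k) * y ^+ k) =
    \sum_(k < M) derive1n k psi b / k`!%:R * moment k g * e ^+ k.
  have [h1 h2] := Rintegral_mul_poly (fun k => derive1n k psi b / k`!%:R * e ^+ k) M sg.
  by split=> //; rewrite h2; apply: eq_bigr => k _; rewrite mulrAC.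
rewrite -RintegralB//.
have im := smooth_moment_integrable M sg.
have ia : mu.-integrable setT (EFin \o (fun y => `|y ^+ M * g y|)).
  exact: integrable_abse im.
have iD := integrableB measurableT ige ip.
apply: le_trans (le_normr_Rintegral measurableT iD) _.
have -> : C * A * e ^+ M =
    Rintegral mu setT (fun y => C * e ^+ M * `|y ^+ M * g y|).
  by rewrite RintegralZl// mulrAC.
apply: le_Rintegral => //.
- exact: integrable_abse iD.
- exact: (integrableZl measurableT (C * e ^+ M) ia).
move=> y _ /=; rewrite -mulrBr !normrM [leRHS]mulrA mulrC ler_wpM2r//.
have := taylor_bound dpsi hC b (e * y); rewrite normrM exprMn (gtr0_norm e0).
rewrite mulrA normrX; congr (`|_ - _| <= _).
by apply: eq_bigr => k _; rewrite exprMn mulrA.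
Qed.

(** The coefficients are shifted by one place and a zero coefficient is put in front. *)
Lemma up_to_order_pred (p : int) (F : R -> R) :
  up_to_order (p + 1) F -> up_to_order p F.
Proof.
move=> [eta h]; exists (fun i => if i is j.+1 then eta j else 0) => -[|N].
  (* For the empty sum a bound by [e ^ (p + 1)] must be weakened to one by [e ^ p]: this uses
     [e <= 1], and [|C|] because the sign of [C] is unknown. *)
  have [C [d [d0 hd]]] := h 0%N; exists `|C|, (Num.min d 1); split.
    by rewrite lt_min d0 ltr01.
  move=> e e0; rewrite le_min => /andP[ed e1]; have := hd e e0 ed.
  rewrite !big_ord0 !addr0 => H; apply: le_trans H _.
  have ep : 0 < e ^ p by rewrite exprz_gt0.
  rewrite expfzDr ?gt_eqF// expr1z.
  apply: (@le_trans _ _ (`|C| * (e ^ p * e))).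
    by rewrite ler_wpM2r ?ler_norm// mulr_ge0 ?ltW.
  by rewrite ler_wpM2l// ler_piMr// ltW.
have [C [d [d0 hd]]] := h N; exists C, d; split=> // e e0 ed.
rewrite big_ord_recl /= mul0r add0r.
have E (i : nat) : p + i.+1%:Z = p + 1 + i%:Z by rewrite -add1n PoszD addrA.
under eq_bigr do rewrite /bump/= add1n E.
by rewrite E; exact: hd.
Qed.

Lemma up_to_order_le (p q : int) (F : R -> R) :
  p <= q -> up_to_order q F -> up_to_order p F.
Proof.
move=> pq; have -> : q = p + `|q - p|%N%:Z by rewrite gez0_abs ?subr_ge0// subrKC.
elim: `|q - p|%N => [|k IH]; first by rewrite addr0.
by rewrite -addn1 PoszD addrA => /up_to_order_pred.
Qed.

Lemma up_to_order_expansion n (a : nat -> R) (F : R -> R) :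
  (forall k, (k < n)%N -> a k = 0) ->
  (forall M, exists C, forall e, 0 < e ->
    `|F e - \sum_(k < M) a k * e ^+ k| <= C * e ^+ M) ->
  up_to_order n%:Z F.
Proof.
move=> a0 hF; exists (fun i => a (n + i)%N) => N.
have [C hC] := hF (n + N)%N; exists C, 1; split=> // e e0 _.
have := hC e e0; rewrite big_split_ord/= big1 ?add0r; last first.
  by move=> i _; rewrite a0 ?mul0r.
by rewrite -PoszD -exprnP.
Qed.

(** At [y = (x - t/2) / e] one has [w_t = - theta y / (2 e)] and [w w_x = K y * theta y / e], with
    sum [theta y * (K y - 1/2) / e]. The substitution [x = t/2 + e y] absorbs the factor [1 / e]. *)
Lemma hopf_pairing_shock_wave K theta psi t e : 0 < e ->
  (forall x, is_derive x 1 K (theta x)) -> continuous theta ->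
  primitive theta = K -> continuous psi ->
  hopf_pairing (shock_wave 0 1 2^-1 theta) psi t e =
  Rintegral mu setT (fun y => theta y * (K y - 2^-1) * psi (2^-1 * t + e * y)).
Proof.
move=> e0 dK ct pK cpsi; have en0 : e != 0 by rewrite gt_eqF.
have cK := is_derive_continuous dK.
pose G y := theta y * (K y - 2^-1) * psi (2^-1 * t + e * y).
have cG : continuous G.
  move=> y; apply: cvgM.
    by apply: cvgM; [exact: ct|apply: cvgB; [exact: cK|exact: cvg_cst]].
  apply: continuous_comp; last exact: cpsi.
  apply: cvgD; first exact: cvg_cst.
  by apply: cvgM; [exact: cvg_cst|exact: cvg_id].
rewrite -(Rintegral_affine_substitution (2^-1 * t) e0 cG).
apply: eq_Rintegral => x _; rewrite /shock_wave pK /G.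
have -> : 2^-1 * t + e * ((x - 2^-1 * t) / e) = x by field.
have dl : is_derive t 1 (fun s => 0 + 1 * K ((x - 2^-1 * s) / e))
    (theta ((x - 2^-1 * t) / e) * (- 2^-1 / e)).
  have d1 : is_derive t 1 (fun s : R => (x - 2^-1 * s) / e) (- 2^-1 / e).
    refine (eq_is_derive (is_deriveZ e^-1 (is_deriveB (is_derive_cst x t 1)
      (is_deriveZ 2^-1 (is_derive_id t (1 : R))))) _ _).
      by move=> s; rewrite [RHS]mulrC.
    by rewrite /GRing.scale/=; ring.
  refine (eq_is_derive (is_derive1_comp (dK _) d1) _ _) => //.
  by move=> s; rewrite add0r mul1r.
have dx : is_derive x 1 (fun y => 0 + 1 * K ((y - 2^-1 * t) / e))
    (theta ((x - 2^-1 * t) / e) / e).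
  have d1 : is_derive x 1 (fun y : R => (y - 2^-1 * t) / e) e^-1.
    refine (eq_is_derive (is_deriveZ e^-1 (is_deriveB (is_derive_id x (1 : R))
      (is_derive_cst (2^-1 * t) x 1))) _ _).
      by move=> s; rewrite [RHS]mulrC.
    by rewrite /GRing.scale/=; ring.
  refine (eq_is_derive (is_derive1_comp (dK _) d1) _ _) => //.
  by move=> s; rewrite add0r mul1r.
rewrite (is_derive_derive1 dl) (is_derive_derive1 dx).
by field.
Qed.

End Asymptotics.

Theorem theorem3 (R : realType) (T : R) (hT : 0 < T) (p : int) :
  exists (h0 dh a : R) (theta : R -> R),
    [/\ dh != 0, schwartz theta,
        Rintegral (@lebesgue_measure R) setT theta = 1,
        (forall t : R, 0 <= t <= T -> forall psi : R -> R, schwartz psi ->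
           up_to_order p (hopf_pairing (shock_wave h0 dh a theta) psi t))
      & (a - h0) / dh = 1 / 2].
Proof.
(* The integer [p] may be negative, so the construction is carried out at the natural order
   [|p| >= p] and the order is lowered at the end by [up_to_order_le]. *)
have [K [theta [[st dK] [K0 K1] sg mg]]] := shock_profile (R := R) `|p|%N.
have ct := smooth_continuous st.
have it := rapid_integrable ct (smooth_in st).
have pK : primitive theta = K.
  apply/funext => x.
  by rewrite /primitive (Rintegral_FTC2_itvNyc x dK ct it K0) subr0.
exists 0, 1, 2^-1, theta; split.
- exact: oner_neq0.
- exact: smooth_rapid_schwartz.
- by rewrite (Rintegral_FTC2_setT dK ct it K0 K1) subr0.
- move=> t _ psi spsi; apply: (@up_to_order_le _ _ `|p|%N%:Z).
    by rewrite abszE ler_norm.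
  have [dpsi _] := spsi.
  have cpsi := derivable_continuous (dpsi 0%N).
  (* Each coefficient carries a moment of [theta * (K - 1/2)] as a factor, hence vanishes for
     [k < |p|], whatever the test function [psi]. *)
  apply: (@up_to_order_expansion _ _ (fun k => derive1n k psi (2^-1 * t) / k`!%:R *
      moment k (fun x => theta x * (K x - 2^-1)))).
    by move=> k kp; rewrite mg ?mulr0// ltnW.
  move=> M; have [C hC] := moment_expansion (2^-1 * t) M sg spsi.
  by exists C => e e0; rewrite (hopf_pairing_shock_wave _ e0 dK ct pK cpsi); exact: hC.
- by rewrite subr0 divr1 div1r.
Qed.
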